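(* For $n\ge0$ define $$\widehat{\widehat P}_n=\sum_{\sigma\in\mathfrak D_{2n}}x_1^{\mathrm{eareccpeak}(\sigma)}x_2^{\mathrm{eareccdfall}(\sigma)}y_1^{\mathrm{ereccval}(\sigma)}\hat y_2^{\mathrm{ereccdrise}'(\sigma)}u_1^{\mathrm{nrcpeak}(\sigma)}u_2^{\mathrm{nrcdfall}(\sigma)}v_1^{\mathrm{nrcval}(\sigma)}\hat v_2^{\mathrm{nrcdrise}'(\sigma)}w_{\mathrm e}^{\mathrm{evennrfix}(\sigma)}w_{\mathrm o}^{\mathrm{oddnrfix}(\sigma)}z_{\mathrm e}^{\mathrm{evenrar}(\sigma)}z_{\mathrm o}^{\mathrm{oddrar}(\sigma)}$$ $$\times\,p_{-1}^{\mathrm{lcrosscpeak}(\sigma)}p_{-2}^{\mathrm{lcrosscdfall}(\sigma)}p_{+1}^{\mathrm{ucrosscval}(\sigma)}\hat p_{+2}^{\mathrm{ucrosscdrise}'(\sigma)}q_{-1}^{\mathrm{lnestcpeak}(\sigma)}q_{-2}^{\mathrm{lnestcdfall}(\sigma)}q_{+1}^{\mathrm{unestcval}(\sigma)}\hat q_{+2}^{\mathrm{unestcdrise}'(\sigma)}s_{\mathrm e}^{\mathrm{epsnest}(\sigma)}s_{\mathrm o}^{\mathrm{opsnest}(\sigma)}\lambda^{\mathrm{cyc}(\sigma)}.$$ Under the specialization $v_1=y_1$ and $q_{+1}=p_{+1}$, $\sum_{n\ge0}\widehat{\widehat P}_nt^n$ equals the T-type continued fraction with coefficients $\alpha_{2k-1}=(\lambda+k-1)\,p_{+1}^{k}\,y_1\,\bigl(p_{-1}^{k-1}x_1+q_{-1}[k-1]_{p_{-1},q_{-1}}u_1\bigr)$,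 $\alpha_{2k}=\bigl(p_{-2}^{k-1}x_2+q_{-2}[k-1]_{p_{-2},q_{-2}}u_2+\lambda s_{\mathrm e}^kw_{\mathrm e}\bigr)\bigl(\hat p_{+2}^{k-1}\hat y_2+\hat q_{+2}[k-1]_{\hat p_{+2},\hat q_{+2}}\hat v_2+\lambda s_{\mathrm o}^kw_{\mathrm o}\bigr)$ for $k\ge1$, $\delta_1=\lambda^2z_{\mathrm e}z_{\mathrm o}$, $\delta_n=0$ for $n\ge2$.
   Context: $\mathfrak D_{2n}$: permutations $\sigma$ of $[2n]$ with $\sigma(2k-1)\ge2k-1$ and $\sigma(2k)\le2k$ for all $k\in[n]$; $\mathrm{cyc}(\sigma)$ = number of cycles (fixed points included). Index $i$ is a cycle peak / valley / double rise / double fall if respectively $\sigma^{-1}(i)<i>\sigma(i)$ / $\sigma^{-1}(i)>i<\sigma(i)$ / $\sigma^{-1}(i)<i<\sigma(i)$ / $\sigma^{-1}(i)>i>\sigma(i)$. Record: $\sigma(j)<\sigma(i)$ for all $j<i$; antirecord: $\sigma(j)>\sigma(i)$ for all $j>i$; exclusive record/antirecord = record/antirecord but not both; record-antirecord = both; neither-record-antirecord = neither. $\mathrm{eareccpeak},\mathrm{eareccdfall}$ = exclusive antirecords that are cycle peaks, resp. double falls; $\mathrm{ereccval}$ = exclusive records that are cycle valleys; $\mathrm{nrcpeak},\mathrm{nrcdfall},\mathrm{nrcval}$ = neither-record-antirecords that are cycle peaks, double falls, valleys; $\mathrm{ereccdrise}'$ (resp. $\mathrm{nrcdrise}'$) =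 number of cycle double rises $i$ with $\sigma^{-1}(i)$ a record (resp. not a record); $\mathrm{evennrfix},\mathrm{oddnrfix}$ = even/odd fixed points that are neither-record-antirecords; $\mathrm{evenrar},\mathrm{oddrar}$ = even/odd record-antirecords. $\mathrm{ucross}(j,\sigma)=\#\{(i,k,l):i<j<k<l,k=\sigma(i),l=\sigma(j)\}$, $\mathrm{unest}(j,\sigma)=\#\{(i,k,l):i<j<k<l,k=\sigma(j),l=\sigma(i)\}$, $\mathrm{lcross}(k,\sigma)=\#\{(i,j,l):i<j<k<l,i=\sigma(k),j=\sigma(l)\}$, $\mathrm{lnest}(k,\sigma)=\#\{(i,j,l):i<j<k<l,i=\sigma(l),j=\sigma(k)\}$, $\mathrm{ucross}'(k,\sigma)=\#\{(i,j,l):i<j<k<l,k=\sigma(i),l=\sigma(j)\}$, $\mathrm{unest}'(k,\sigma)=\#\{(i,j,l):i<j<k<l,k=\sigma(j),l=\sigma(i)\}$. $\mathrm{ucrosscval},\mathrm{unestcval}$ = sums of ucross, unest over cycle valleys; $\mathrm{lcrosscpeak},\mathrm{lnestcpeak}$ = sums of lcross, lnest over cycle peaks; $\mathrm{lcrosscdfall},\mathrm{lnestcdfall}$ = same over cycle double falls; $\mathrm{ucrosscdrise}',\mathrm{unestcdrise}'$ = sums of $\mathrm{ucross}',\mathrm{unest}'$ over cycle double rises. For a fixed point $j$, $\mathrm{psnest}(j,\sigma)=\#\{i<j:\sigma(i)>j\}$; $\mathrm{epsnest},\mathrm{opsnest}$ = sums over even/odd fixed points. $[n]_{p,q}=\sum_{j=0}^{n-1}p^jq^{n-1-j}$.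 T-type continued fraction: $1/(1-\delta_1t-\alpha_1t/(1-\delta_2t-\alpha_2t/(1-\delta_3t-\cdots)))$.
   Formalization: In $\alpha_{2k-1}$ the factor $p_{+1}^{k}$ is corrected to $p_{+1}^{k-1}$: the printed form already fails at $n=1$, where $\widehat{\widehat P}_1=\lambda^2z_ez_o+\lambda x_1y_1$ contains no $p_{+1}$. *)

(* Defs.v *)
From mathcomp Require Import all_boot all_fingroup all_algebra.

Set Implicit Arguments.
Unset Strict Implicit.
Unset Printing Implicit Defensive.

Import GRing.Theory.

(* Permutations of [N] are elements of 'S_N = {perm 'I_N}.  The paper's index
   i in {1, ..., N} is the ordinal of value i - 1, so order comparisons are
   unchanged but parities have to be read off [label i]. *)
Definition label (N : nat) (i : 'I_N) : nat := i.+1.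

Definition in_D (n : nat) (s : 'S_(n.*2)) : bool :=
  [forall i, if odd (label i) then i <= s i else s i <= i].

Definition ncyc (N : nat) (s : 'S_N) : nat := #|porbits s|.

Definition cpeak (N : nat) (s : 'S_N) (i : 'I_N) : bool :=
  ((s^-1)%g i < i) && (s i < i).
Definition cval (N : nat) (s : 'S_N) (i : 'I_N) : bool :=
  (i < (s^-1)%g i) && (i < s i).
Definition cdrise (N : nat) (s : 'S_N) (i : 'I_N) : bool :=
  ((s^-1)%g i < i) && (i < s i).
Definition cdfall (N : nat) (s : 'S_N) (i : 'I_N) : bool :=
  (i < (s^-1)%g i) && (s i < i).
Definition fixpt (N : nat) (s : 'S_N) (i : 'I_N) : bool := s i == i.

Definition record (N : nat) (s : 'S_N) (i : 'I_N) : bool :=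
  [forall j : 'I_N, (j < i) ==> (s j < s i)].
Definition antirecord (N : nat) (s : 'S_N) (i : 'I_N) : bool :=
  [forall j : 'I_N, (i < j) ==> (s i < s j)].
Definition erec (N : nat) (s : 'S_N) (i : 'I_N) : bool :=
  record s i && ~~ antirecord s i.
Definition earec (N : nat) (s : 'S_N) (i : 'I_N) : bool :=
  antirecord s i && ~~ record s i.
Definition rar (N : nat) (s : 'S_N) (i : 'I_N) : bool :=
  record s i && antirecord s i.
Definition nrar (N : nat) (s : 'S_N) (i : 'I_N) : bool :=
  ~~ record s i && ~~ antirecord s i.

Definition eareccpeak (N : nat) (s : 'S_N) : nat :=
  #|[set i | earec s i & cpeak s i]|.
Definition eareccdfall (N : nat) (s : 'S_N) : nat :=
  #|[set i | earec s i & cdfall s i]|.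
Definition ereccval (N : nat) (s : 'S_N) : nat :=
  #|[set i | erec s i & cval s i]|.
Definition ereccdrise' (N : nat) (s : 'S_N) : nat :=
  #|[set i | cdrise s i & record s ((s^-1)%g i)]|.
Definition nrcpeak (N : nat) (s : 'S_N) : nat :=
  #|[set i | nrar s i & cpeak s i]|.
Definition nrcdfall (N : nat) (s : 'S_N) : nat :=
  #|[set i | nrar s i & cdfall s i]|.
Definition nrcval (N : nat) (s : 'S_N) : nat :=
  #|[set i | nrar s i & cval s i]|.
Definition nrcdrise' (N : nat) (s : 'S_N) : nat :=
  #|[set i | cdrise s i & ~~ record s ((s^-1)%g i)]|.
Definition evennrfix (N : nat) (s : 'S_N) : nat :=
  #|[set i | [&& ~~ odd (label i), fixpt s i & nrar s i]]|.
Definition oddnrfix (N : nat) (s : 'S_N) : nat :=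
  #|[set i | [&& odd (label i), fixpt s i & nrar s i]]|.
Definition evenrar (N : nat) (s : 'S_N) : nat :=
  #|[set i | ~~ odd (label i) & rar s i]|.
Definition oddrar (N : nat) (s : 'S_N) : nat :=
  #|[set i | odd (label i) & rar s i]|.

Definition ucross (N : nat) (s : 'S_N) (j : 'I_N) : nat :=
  #|[set t : 'I_N * 'I_N * 'I_N | let: (i, k, l) := t in
      [&& i < j, j < k, k < l, k == s i & l == s j]]|.
Definition unest (N : nat) (s : 'S_N) (j : 'I_N) : nat :=
  #|[set t : 'I_N * 'I_N * 'I_N | let: (i, k, l) := t in
      [&& i < j, j < k, k < l, k == s j & l == s i]]|.
Definition lcross (N : nat) (s : 'S_N) (k : 'I_N) : nat :=
  #|[set t : 'I_N * 'I_N * 'I_N | let: (i, j, l) := t in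
      [&& i < j, j < k, k < l, i == s k & j == s l]]|.
Definition lnest (N : nat) (s : 'S_N) (k : 'I_N) : nat :=
  #|[set t : 'I_N * 'I_N * 'I_N | let: (i, j, l) := t in
      [&& i < j, j < k, k < l, i == s l & j == s k]]|.
Definition ucross' (N : nat) (s : 'S_N) (k : 'I_N) : nat :=
  #|[set t : 'I_N * 'I_N * 'I_N | let: (i, j, l) := t in
      [&& i < j, j < k, k < l, k == s i & l == s j]]|.
Definition unest' (N : nat) (s : 'S_N) (k : 'I_N) : nat :=
  #|[set t : 'I_N * 'I_N * 'I_N | let: (i, j, l) := t in
      [&& i < j, j < k, k < l, k == s j & l == s i]]|.
Definition psnest (N : nat) (s : 'S_N) (j : 'I_N) : nat :=
  #|[set i : 'I_N | i < j & j < s i]|.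

Definition ucrosscval (N : nat) (s : 'S_N) : nat :=
  \sum_(j | cval s j) ucross s j.
Definition unestcval (N : nat) (s : 'S_N) : nat :=
  \sum_(j | cval s j) unest s j.
Definition lcrosscpeak (N : nat) (s : 'S_N) : nat :=
  \sum_(k | cpeak s k) lcross s k.
Definition lnestcpeak (N : nat) (s : 'S_N) : nat :=
  \sum_(k | cpeak s k) lnest s k.
Definition lcrosscdfall (N : nat) (s : 'S_N) : nat :=
  \sum_(k | cdfall s k) lcross s k.
Definition lnestcdfall (N : nat) (s : 'S_N) : nat :=
  \sum_(k | cdfall s k) lnest s k.
Definition ucrosscdrise' (N : nat) (s : 'S_N) : nat :=
  \sum_(k | cdrise s k) ucross' s k.
Definition unestcdrise' (N : nat) (s : 'S_N) : nat :=
  \sum_(k | cdrise s k) unest' s k.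
Definition epsnest (N : nat) (s : 'S_N) : nat :=
  \sum_(j | fixpt s j && ~~ odd (label j)) psnest s j.
Definition opsnest (N : nat) (s : 'S_N) : nat :=
  \sum_(j | fixpt s j && odd (label j)) psnest s j.

Local Open Scope ring_scope.

(* Values of the indeterminates.  Names: m/p after p, q stand for the signs
   -/+ of the index, h for the hat, e/o for the index even/odd. *)
Record weights (R : Type) := Weights {
  x1 : R; x2 : R; y1 : R; hy2 : R;
  u1 : R; u2 : R; v1 : R; hv2 : R;
  we : R; wo : R; ze : R; zo : R;
  pm1 : R; pm2 : R; pp1 : R; hpp2 : R;
  qm1 : R; qm2 : R; qp1 : R; hqp2 : R;
  se : R; so : R; lam : R
}.

Definition Phh (R : comNzRingType) (W : weights R) (n : nat) : R :=
  \sum_(s : 'S_(n.*2) | in_D s)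
    (x1 W ^+ eareccpeak s * x2 W ^+ eareccdfall s
   * y1 W ^+ ereccval s * hy2 W ^+ ereccdrise' s
   * u1 W ^+ nrcpeak s * u2 W ^+ nrcdfall s
   * v1 W ^+ nrcval s * hv2 W ^+ nrcdrise' s
   * we W ^+ evennrfix s * wo W ^+ oddnrfix s
   * ze W ^+ evenrar s * zo W ^+ oddrar s
   * pm1 W ^+ lcrosscpeak s * pm2 W ^+ lcrosscdfall s
   * pp1 W ^+ ucrosscval s * hpp2 W ^+ ucrosscdrise' s
   * qm1 W ^+ lnestcpeak s * qm2 W ^+ lnestcdfall s
   * qp1 W ^+ unestcval s * hqp2 W ^+ unestcdrise' s
   * se W ^+ epsnest s * so W ^+ opsnest s
   * lam W ^+ ncyc s).

Definition pq_int (R : comNzRingType) (n : nat) (p q : R) : R :=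
  \sum_(j < n) p ^+ j * q ^+ (n.-1 - j).

(* Formal power series in t are coefficient sequences. *)
Definition fps_one (R : comNzRingType) (n : nat) : R := (n == 0%N)%:R.

Definition fps_mul (R : comNzRingType) (f g : nat -> R) (n : nat) : R :=
  \sum_(k < n.+1) f k * g (n - k)%N.

(* First n coefficients of 1 / g, when g has constant term 1; see
   [fps_mul_inv]. *)
Fixpoint fps_inv_prefix (R : comNzRingType) (g : nat -> R) (n : nat) : seq R :=
  if n is m.+1 then
    let c := fps_inv_prefix g m in
    rcons c ((m == 0%N)%:R - \sum_(k < m) c`_k * g (m - k)%N)
  else [::].

Definition fps_inv (R : comNzRingType) (g : nat -> R) (n : nat) : R :=
  (fps_inv_prefix g n.+1)`_n.

(* 1 - d t - a t F(t) *)
Definition T_denominator (R : comNzRingType) (d a : R) (F : nat -> R)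
    (n : nat) : R :=
  if n is m.+1 then - (d *+ (m == 0%N)) - a * F m else 1.

(* 1 / (1 - delta_i t - alpha_i t / ( ... )), cut off after m levels. *)
Fixpoint T_convergent (R : comNzRingType) (delta alpha : nat -> R)
    (m i : nat) : nat -> R :=
  if m is m'.+1 then
    fps_inv (T_denominator (delta i) (alpha i)
               (T_convergent delta alpha m' i.+1))
  else @fps_one R.

(* f is the t-adic limit of the convergents; the coefficients of the fraction
   are delta_1, alpha_1, delta_2, alpha_2, ... and index 0 is never used. *)
Definition is_T_fraction (R : comNzRingType) (delta alpha : nat -> R)
    (f : nat -> R) : Prop :=
  forall n : nat, exists M : nat, forall m : nat, (M <= m)%N ->
    T_convergent delta alpha m 1 n = f n.

Lemma size_fps_inv_prefix (R : comNzRingType) (g : nat -> R) n :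
  size (fps_inv_prefix g n) = n.
Proof. by elim: n => //= n IHn; rewrite size_rcons IHn. Qed.

Lemma nth_fps_inv_prefix (R : comNzRingType) (g : nat -> R) n k :
  (k < n)%N -> (fps_inv_prefix g n)`_k = fps_inv g k.
Proof.
elim: n => // n IHn; rewrite ltnS leq_eqVlt => /predU1P[-> //|lt_kn].
by rewrite /= nth_rcons size_fps_inv_prefix lt_kn IHn.
Qed.

Lemma fps_mul_inv (R : comNzRingType) (g : nat -> R) :
  g 0%N = 1 -> fps_mul (fps_inv g) g =1 @fps_one R.
Proof.
move=> g0 n; rewrite /fps_mul big_ord_recr /= subnn g0 mulr1.
rewrite {2}/fps_inv /= nth_rcons size_fps_inv_prefix ltnn eqxx.
rewrite [X in _ + (_ - X)](eq_bigr (fun k : 'I_n => fps_inv g k * g (n - k)%N)).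
  by rewrite addrC subrK.
by move=> k _; rewrite nth_fps_inv_prefix.
Qed.

(* Main.v *)
Require Import Defs.
From mathcomp Require Import all_boot all_fingroup all_algebra.
From mathcomp Require Import zify ring.

(* Read a permutation from left to right, recording at time [n] only the arcs
   among the first [n] points: a partial injection with as many open sources as
   open targets; call this number the height.  The next point opens a source and
   a target (valley), moves one of them (double rise, double fall), closes one of
   each (peak), or is fixed.  All the statistics are determined locally: crossings
   and nestings by the rank of the closed source or target among the open ones,
   and since v1 = y1 and q_{+1} = p_{+1} a valley at height h weighs y1 p_{+1}^h.
   For a given target closed by a peak, exactly one of the h open sources, the end
   of the path starting at that target, completes a cycle, whence the factor
   lambda + h - 1.  Hence the sum over permutations is a sum over weighted Motzkin
   paths.  For D-permutations the paths alternate between two kinds of steps, and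
   they are Dyck paths (with a long level step at height 0), whose generating
   function is the T-fraction. *)

Set Implicit Arguments.
Unset Strict Implicit.
Unset Printing Implicit Defensive.

Import GRing.Theory.
Local Open Scope ring_scope.

(** * Partial injections *)

Section PartialInjections.
Variable N : nat.
Implicit Types (s : 'S_N) (f : {ffun 'I_N -> option 'I_N}) (i k a b x y : 'I_N).

Definition pinj (n : nat) f : Prop :=
  (forall a b, f a = Some b -> (a < n)%N /\ (b < n)%N) /\
  (forall a a' b, f a = Some b -> f a' = Some b -> a = a').

Definition restr (n : nat) s : {ffun 'I_N -> option 'I_N} :=
  [ffun a : 'I_N => if ((a < n) && (s a < n))%N then Some (s a) else None].

(** These are the open sources, still waiting for an image; [tgts] collects the open targets, still
    waiting for a preimage. *)
Definition srcs (n : nat) f : {set 'I_N} :=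
  [set a : 'I_N | (a < n)%N && (f a == None)].
Definition tgts (n : nat) f : {set 'I_N} :=
  [set b : 'I_N | (b < n)%N && [forall a, f a != Some b]].

(** Both sets are complements within the points below [n]: one of the domain of [f], the other of
    its image, which has the same size by injectivity. *)
Lemma card_tgts n f : pinj n f -> #|tgts n f| = #|srcs n f|.
Proof.
move=> [lt_f inj_f].
pose D := [set a | f a != None].
pose V := [set x : 'I_N | (x < n)%N].
pose F x := odflt x (f x).
have DV : D \subset V.
  by apply/subsetP => a; rewrite !inE; case E: (f a) => [b|] // _; have [] := lt_f _ _ E.
have FV : F @: D \subset V.
  apply/subsetP => b /imsetP[a]; rewrite inE => Da ->; rewrite inE /F.
  by case E: (f a) Da => [c|] // _; have [] := lt_f _ _ E.
have -> : srcs n f = V :\: D.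
  by apply/setP => a; rewrite !inE negbK andbC.
have -> : tgts n f = V :\: F @: D.
  apply/setP => b; rewrite !inE andbC; congr (_ && _).
  apply/forallP/negP => [nf /imsetP[a]|nf a].
    rewrite inE => Da bE; have := nf a; rewrite bE /F.
    by case: (f a) Da => //= c _; rewrite eqxx.
  apply/eqP => fa; apply: nf; apply/imsetP; exists a; rewrite ?inE ?fa //.
  by rewrite /F fa.
rewrite !cardsDS //; congr (_ - _)%N; apply: card_in_imset => a a'.
rewrite !inE /F; case E: (f a) => [b|] // _; case E': (f a') => [b'|] //= _ bb.
by apply: inj_f E _; rewrite bb.
Qed.

(** [odflt] makes the iteration stationary once no arc leaves; from an open target, [N] steps
    suffice to get there. *)
Definition path_end f x : 'I_N := iter N (fun y => odflt y (f y)) x.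

Lemma path_end_stop f x m :
  f (iter m (fun y => odflt y (f y)) x) = None ->
  forall m', (m <= m')%N -> iter m' (fun y => odflt y (f y)) x =
    iter m (fun y => odflt y (f y)) x.
Proof.
move=> fN m' /subnK <-; elim: (m' - m)%N => //= d ->.
by rewrite fN.
Qed.

(** A path that never stopped would visit [N.+1] distinct points of ['I_N]: by injectivity a
    repetition can be pulled back to the start [b], which has no preimage. *)
Lemma path_end_srcs n f b : pinj n f -> b \in tgts n f ->
  path_end f b \in srcs n f.
Proof.
move=> [lt_f inj_f]; rewrite !inE => /andP[ltb /forallP nb].
rewrite /path_end; set g := fun y => odflt y (f y).
have lt_g m : (iter m g b < n)%N.
  elim: m => //= m IH; rewrite {1}/g; case E: (f _) => [c|] //=.
  by case: (lt_f _ _ E).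
rewrite lt_g /=; apply/eqP; case EN: (f _) => [c|] //; exfalso.
have def m : (m <= N)%N -> f (iter m g b) = Some (iter m.+1 g b).
  move=> leN; case E: (f (iter m g b)) => [d|]; first by rewrite /= {1}/g E.
  by have := path_end_stop E leN; rewrite -/g => eN; rewrite eN E in EN.
have inj_it p q : (p <= N)%N -> (p + q <= N)%N -> iter p g b = iter (p + q) g b ->
    q = 0%N.
  elim: p => [|p IH] lep leq.
    case: q leq => // q leq; rewrite add0n in leq *.
    by move=> eb; have := nb (iter q g b); rewrite (def _ (ltnW leq)) -eb eqxx.
  move=> e; apply: IH; [lia|lia|].
  have := def p (ltnW lep); rewrite e => e1; apply: inj_f e1 _.
  by rewrite def; [|lia].
have : injective (fun m : 'I_N.+1 => iter m g b).
  move=> p q e; apply: val_inj => /=.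
  wlog le : p q e / (p <= q)%N.
    by move=> H; case: (leqP p q) => [/H->//|/ltnW/H->].
  have := @inj_it p (q - p)%N; rewrite subnKC // => /(_ _ _ e) H.
  have := H (ltn_ord p) (ltn_ord q); lia.
by move/leq_card; rewrite !card_ord ltnn.
Qed.

(* The arcs at [i] among the points [<= i]: [None] for a loop, otherwise the
   source of the incoming arc and the target of the outgoing one, when these are
   smaller than [i]. *)
Definition code s i : option (option 'I_N * option 'I_N) :=
  if s i == i then None else
  Some (if ((s^-1)%g i < i)%N then Some ((s^-1)%g i) else None,
        if (s i < i)%N then Some (s i) else None).

Definition ext f i (c : option (option 'I_N * option 'I_N)) :=
  match c with
  | None => [ffun x => if x == i then Some i else f x]
  | Some (a, b) =>
    [ffun x => if x == i then b else if Some x == a then Some i else f x]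
  end.

Definition admissible f i (c : option (option 'I_N * option 'I_N)) : bool :=
  if c is Some (a, b) then
    (if a is Some x then x \in srcs i f else true) &&
    (if b is Some y then y \in tgts i f else true)
  else true.

Lemma srcs_restr n s a : (a \in srcs n (restr n s)) = (a < n <= s a)%N.
Proof. by rewrite inE ffunE; case: (ltnP a n) => // _; case: ltnP. Qed.

Lemma tgts_restr n s b : (b \in tgts n (restr n s)) = (b < n <= (s^-1)%g b)%N.
Proof.
rewrite inE; case: ltnP => //= ltb; apply/forallP/idP => [H|le a].
  rewrite leqNgt; apply/negP => lt; have := H ((s^-1)%g b).
  by rewrite ffunE permKV lt ltb eqxx.
rewrite ffunE; case: ifP => // /andP[lta _]; apply/eqP => -[sa].
by move: le; rewrite -sa permK leqNgt lta.
Qed.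

Lemma admissible_code s i : admissible (restr i s) i (code s i).
Proof.
rewrite /admissible /code; case: eqP => // ne.
by apply/andP; split; [case: (boolP ((s^-1)%g i < i)%N)|case: (boolP (s i < i)%N)] => // lt;
  rewrite ?srcs_restr ?tgts_restr ?permKV ?permK lt leqnn.
Qed.

Lemma pinj_ext f i c : pinj i f -> admissible f i c -> pinj i.+1 (ext f i c).
Proof.
move=> [lt_f inj_f] adm.
have nfi a : f a <> Some i by move=> /lt_f[_]; rewrite ltnn.
have lt_f' a b : f a = Some b -> (a < i.+1)%N /\ (b < i.+1)%N.
  by move=> /lt_f[? ?]; split; apply: leqW.
case: c adm => [[oa ob]|] /= adm; split => [a b|a a' b]; rewrite !ffunE.
- case: eqP => [-> /= E|_].
    rewrite ltnSn; split=> //; move: adm; rewrite E => /andP[_].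
    by rewrite inE => /andP[/ltnW].
  case: eqP => [E [<-]|_]; last exact: lt_f'.
  by rewrite ltnSn; split=> //; move: adm; rewrite -E inE => /andP[/andP[/ltnW]].
- case/andP: adm => adma admb.
  have nb : ob = Some b -> (b < i)%N /\ forall a, f a <> Some b.
    move=> E; move: admb; rewrite E inE => /andP[-> /forallP H]; split=> // x.
    by apply/eqP.
  case: (a =P i) => [->|_]; case: (a' =P i) => [->//|_].
  + move=> /nb[lb nfb]; case: eqP => [_ [e]|_ /nfb//].
    by rewrite e ltnn in lb.
  + case: eqP => [_ [e] /nb[]|_ fa /nb[_ /(_ _ fa)//]].
    by rewrite e ltnn.
  + case: eqP => [E [<-]|_ fa]; case: eqP => [E'|_].
    * by move: E'; rewrite -E => -[->].
    * by move/nfi.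
    * by move=> [e]; move: fa; rewrite -e => /nfi.
    * exact: inj_f fa.
- by case: eqP => [-> [<-]|_]; [rewrite ltnSn|apply: lt_f'].
- case: (a =P i) => [-> [<-]|_]; case: (a' =P i) => [->//|_]; first by move/nfi.
    by move=> fa [e]; case: (nfi a); rewrite fa e.
  exact: inj_f.
Qed.

Lemma ltSE x i : (x < i.+1)%N = (x == i) || (x < i)%N.
Proof. by rewrite ltnS leq_eqVlt. Qed.

Lemma restrS s i : restr i.+1 s = ext (restr i s) i (code s i).
Proof.
apply/ffunP => x; rewrite /ext /code; case: eqP => [si|/eqP si]; rewrite !ffunE !ltSE.
  case: eqP => [->|/eqP nx]; first by rewrite si eqxx.
  have /negPf-> // : s x != i.
  by apply: contra nx => /eqP e; apply/eqP/(@perm_inj _ s); rewrite e.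
case: eqP => [->|/eqP nx]; first by rewrite (negPf si).
case: (boolP ((s^-1)%g i < i)%N) => lt.
  have -> : (Some x == Some ((s^-1)%g i)) = (s x == i).
    by rewrite -[RHS](inj_eq (@perm_inj _ (s^-1)%g)) permK.
  case: eqP => [e|//] /=.
  have -> : x = (s^-1)%g i by rewrite -e permK.
  by rewrite lt permKV ?orbT.
case: (ltnP x i) => //= ltx; case: (s x =P i) => [e|//].
by case/negP: lt; have -> : (s^-1)%g i = x by rewrite -e permK.
Qed.

Lemma restr_widen n s a : (restr n s a) =
  if restr n.+1 s a is Some b then (if ((a < n) && (b < n))%N then Some b else None)
  else None.
Proof.
rewrite !ffunE; case: (ltnP a n) => la; case: (ltnP (s a) n) => lb /=; do ?case: ifP => //=;
  rewrite ?la ?lb //; lia.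
Qed.

(** The code can be read off the extension: the target is the value at [i], the source is the
    preimage of [i] other than [i]. A loop is told apart because an admissible target lies below
    [i]. *)
Lemma ext_inj f i c c' : pinj i f -> admissible f i c -> admissible f i c' ->
  ext f i c = ext f i c' -> c = c'.
Proof.
move=> [lt_f _].
have nfi a : f a <> Some i by move=> /lt_f[_]; rewrite ltnn.
have at_i oa ob : admissible f i (Some (oa, ob)) -> ob <> Some i.
  by move=> /andP[_ H] e; move: H; rewrite e inE ltnn.
have srcE oa ob x : admissible f i (Some (oa, ob)) ->
    (oa == Some x) = (x != i) && (ext f i (Some (oa, ob)) x == Some i).
  move=> /andP[H _]; rewrite ffunE eq_sym; case: (x =P i) => [->|_] /=.
    by apply/eqP => e; move: H; rewrite -e inE ltnn.
  by case: eqP => [_|_]; rewrite ?eqxx //; apply/esym/eqP/nfi.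
case: c c' => [[a b]|] [[a' b']|] // adm adm' E.
- have -> : b = b' by move/ffunP/(_ i): E; rewrite !ffunE eqxx.
  suff -> : a = a' by [].
  have H x : (a == Some x) = (a' == Some x).
    by rewrite (srcE _ _ _ adm) (srcE _ _ _ adm') E.
  case: a {E adm} H => [x /(_ x)|]; first by rewrite eqxx => /esym/eqP.
  by case: a' {adm'} => // x /(_ x); rewrite eqxx.
- by case: (at_i _ _ adm); move/ffunP/(_ i): E; rewrite !ffunE eqxx.
- by case: (at_i _ _ adm'); move/ffunP/(_ i): E; rewrite !ffunE eqxx.
Qed.

(** Forgetting the point [i] recovers [f], and [ext_inj] then recovers [c]. Thus the permutations
    over [f] split according to the next code. *)
Lemma restrS_eq s f i c : pinj i f -> admissible f i c ->
  (restr i.+1 s == ext f i c) = (restr i s == f) && (code s i == c).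
Proof.
move=> pf adm; apply/eqP/andP => [E|[/eqP <- /eqP <-]]; last exact: restrS.
have [lt_f _] := pf.
have fi : f i = None by case Ei: (f i) => [b|] //; have [] := lt_f _ _ Ei; rewrite ltnn.
have fx x : (if f x is Some b then if ((x < i) && (b < i))%N then Some b else None
             else None) = f x.
  by case Ex: (f x) => [b|] //; have [-> ->] := lt_f _ _ Ex.
have Ef : restr i s = f.
  apply/ffunP => x; rewrite restr_widen E.
  case: c adm {E} => [[a b]|] /= adm; rewrite !ffunE; case: (x =P i) => [->|_];
    rewrite ?ltnn ?fi ?fx //; first by case: b {adm}.
  case: eqP => [e|_]; last exact: fx.
  by rewrite ltnn andbF; move: adm; rewrite -e inE => /andP[/andP[_ /eqP ->]].
rewrite Ef eqxx; split=> //; apply/eqP.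
have adm' : admissible f i (code s i) by rewrite -Ef admissible_code.
by apply: (ext_inj pf adm' adm); rewrite -E restrS Ef.
Qed.

(** Without open sources [f] is total, hence one permutation. The boolean, read as 0 or 1, is the
    weight of a walk with no steps left. *)
Lemma restr_full f : pinj N f ->
  #|[set s | restr N s == f]| = (#|srcs N f| == 0%N).
Proof.
move=> [lt_f inj_f]; case: eqP => [/cards0_eq/setP srcs0|/eqP].
  have tot a : f a = Some (odflt a (f a)).
    by have := srcs0 a; rewrite !inE ltn_ord; case: (f a).
  have inj : injective (fun a => odflt a (f a)).
    by move=> a a' e; apply: inj_f (tot a) _; rewrite e -tot.
  rewrite (_ : [set _ | _] = [set perm inj]) ?cards1 //.
  apply/setP => t; rewrite !inE; apply/eqP/eqP => [tf|->].
    by apply/permP => a; rewrite permE -tf ffunE !ltn_ord.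
  by apply/ffunP => a; rewrite ffunE !ltn_ord permE -tot.
rewrite cards_eq0 => /set0Pn[a]; rewrite inE ltn_ord => /eqP fa.
apply/eqP; rewrite cards_eq0 -subset0; apply/subsetP => t.
by rewrite !inE => /eqP tf; move: fa; rewrite -tf ffunE !ltn_ord.
Qed.

(** Unless it is a loop, [i] becomes an open source when no target is given; a given source ceases
    to be open. These are the height changes of the Motzkin path. *)
Lemma card_srcs_ext f i c : pinj i f -> admissible f i c ->
  #|srcs i.+1 (ext f i c)| =
    match c with
    | None => #|srcs i f|
    | Some (None, None) => #|srcs i f|.+1
    | Some (Some _, Some _) => #|srcs i f|.-1
    | Some _ => #|srcs i f|
    end.
Proof.
move=> [lt_f _] adm.
have ni : i \notin srcs i f by rewrite inE ltnn.
have lt1 x : x != i -> (x < i.+1)%N = (x < i)%N.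
  by rewrite ltSE => /negPf->.
have rem_card x : x \in srcs i f -> #|srcs i f :\ x| = #|srcs i f|.-1.
  by move=> sx; rewrite (cardsD1 x (srcs i f)) sx.
have srcsE oa ob : srcs i.+1 (ext f i (Some (oa, ob))) =
    if ob is None then i |: [set x in srcs i f | oa != Some x]
    else [set x in srcs i f | oa != Some x].
  apply/setP => x; rewrite !inE ffunE; case: (x =P i) => [->|/eqP nx].
    by case: ob => [b|]; rewrite !inE ?eqxx ltnn ltnSn //=.
  have -> : (if Some x == oa then Some i else f x) == None = (f x == None) && (oa != Some x).
    by rewrite [oa == _]eq_sym; case: (Some x =P oa); rewrite ?andbF ?andbT.
  by rewrite lt1 //; case: ob => [b|]; rewrite !inE ?(negPf nx) andbA.
have set_None : [set x in srcs i f | None != Some x] = srcs i f.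
  by apply/setP => x; rewrite !inE andbT.
have set_Some y : [set x in srcs i f | Some y != Some x] = srcs i f :\ y.
  by apply/setP => x; rewrite !inE andbC eq_sym; congr (_ && _).
case: c adm => [[[a|] [b|]]|] adm; rewrite ?srcsE ?set_None ?set_Some; move: adm => /= adm.
- by rewrite rem_card //; case/andP: adm.
- have {}adm : a \in srcs i f by case/andP: adm.
  rewrite cardsU1 rem_card // 2!inE (negPf ni) andbF add1n prednK //.
  by apply/card_gt0P; exists a.
- by [].
- by rewrite cardsU1 (negPf ni).
apply: eq_card => x; rewrite !inE ffunE; case: (x =P i) => [->|/eqP nx].
  by rewrite ltnn andbF.
by rewrite lt1.
Qed.

End PartialInjections.

(** The rank within [A] takes each value below [#|A|] once; the induction runs over the initial
    segments of [A]. *)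
Lemma sum_rank (R : nmodType) (N : nat) (A : {set 'I_N}) (F : nat -> R) :
  \sum_(a in A) F #|[set x in A | (x < a)%N]| = \sum_(m < #|A|) F m.
Proof.
pose B k := [set x in A | (x < k)%N].
have step k : (k <= N)%N -> \sum_(a in B k) F #|B a| = \sum_(m < #|B k|) F m.
  elim: k => [|k IHk] lekN.
    have -> : B 0%N = set0 by apply/setP => x; rewrite !inE andbF.
    by rewrite big_set0 cards0 big_ord0.
  pose o := Ordinal lekN.
  have no : o \notin B k by rewrite inE ltnn andbF.
  case: (boolP (o \in A)) => oA.
    have -> : B k.+1 = o |: B k.
      apply/setP => x; rewrite !inE ltnS leq_eqVlt -(inj_eq val_inj) /=.
      by case: eqP => [e|_] //=; rewrite (_ : x = o) ?oA //; apply: val_inj.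
    by rewrite big_setU1 //= IHk ?(ltnW lekN) // cardsU1 no big_ord_recr addrC.
  have -> : B k.+1 = B k.
    apply/setP => x; rewrite !inE ltnS leq_eqVlt; case: eqP => [e|] //=.
    by rewrite (_ : x = o) ?(negPf oA) //; apply: val_inj.
  exact: IHk (ltnW lekN).
have BN : B N = A by apply/setP => x; rewrite !inE ltn_ord andbT.
by have := step N (leqnn N); rewrite BN.
Qed.

(** * Permutations as weighted Motzkin paths *)

Lemma big_optionE (R : nmodType) (T : finType) (P : pred (option T)) (F : option T -> R) :
  \sum_(o | P o) F o = (if P None then F None else 0) + \sum_(x | P (Some x)) F (Some x).
Proof.
rewrite big_mkcond (bigD1 None) //=; congr (_ + _).
rewrite -big_mkcondr /= (reindex_omap Some (@id (option T))); last by case.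
by apply: eq_bigl => x; rewrite eqxx andbT.
Qed.

Section Walks.
Variables (R : comNzRingType) (lam : R).
Variables (fw vw : nat -> nat -> R) (rw lw pw : nat -> nat -> nat -> R).

(* Total weight of the Motzkin walks from height [h] to height [0] which start
   after [n] steps and have [len] steps left. *)
Fixpoint walk (len n h : nat) : R :=
  if len is len'.+1 then
    vw n h * walk len' n.+1 h.+1
    + (fw n h + \sum_(m < h) rw n h m + \sum_(m < h) lw n h m) * walk len' n.+1 h
    + (lam + h.-1%:R) * (\sum_(m < h) pw n h m) * walk len' n.+1 h.-1
  else (h == 0%N)%:R.

Variable N : nat.
Implicit Types (s : 'S_N) (f : {ffun 'I_N -> option 'I_N}) (i a b : 'I_N).

(** A double rise is ranked by its source, a double fall or a peak by its target. The factor [lam]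
    of a peak that completes a cycle appears here; that of a loop is left to [fw]. *)
Definition step_wt f i (c : option (option 'I_N * option 'I_N)) : R :=
  let h := #|srcs i f| in
  match c with
  | None => fw i h
  | Some (None, None) => vw i h
  | Some (Some a, None) => rw i h #|[set x in srcs i f | (x < a)%N]|
  | Some (None, Some b) => lw i h #|[set x in tgts i f | (x < b)%N]|
  | Some (Some a, Some b) =>
      pw i h #|[set x in tgts i f | (x < b)%N]| * (if a == path_end f b then lam else 1)
  end.

Definition local_wt s i : R := step_wt (restr i s) i (code s i).

(** [G] stands for the rest of the walk, which sees only the new height. At height 0 the truncated
    [h.-1] is harmless, since the sum over [pw] is empty. *)
Lemma sum_step_wt f i (G : nat -> R) : pinj i f ->
  \sum_(c | admissible f i c) step_wt f i c * G #|srcs i.+1 (ext f i c)|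
  = let h := #|srcs i f| in
    vw i h * G h.+1
    + (fw i h + \sum_(m < h) rw i h m + \sum_(m < h) lw i h m) * G h
    + (lam + h.-1%:R) * (\sum_(m < h) pw i h m) * G h.-1.
Proof.
move=> pf.
rewrite (eq_bigr (fun c => step_wt f i c * G match c with
    | None => #|srcs i f|
    | Some (None, None) => #|srcs i f|.+1
    | Some (Some _, Some _) => #|srcs i f|.-1
    | Some _ => #|srcs i f|
    end)); last by move=> c adm; rewrite card_srcs_ext.
rewrite big_optionE /=.
rewrite (eq_bigr (fun p : option 'I_N * option 'I_N => (fun oa ob =>
   step_wt f i (Some (oa, ob)) * G match oa, ob with
    | None, None => #|srcs i f|.+1
    | Some _, Some _ => #|srcs i f|.-1
    | _, _ => #|srcs i f|
    end) p.1 p.2)); last by case=> [[a|] [b|]].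
rewrite (eq_bigl (fun p => (fun oa => if oa is Some x then x \in srcs i f else true) p.1 &&
  (fun ob => if ob is Some x then x \in tgts i f else true) p.2)); last by case.
rewrite -(pair_big (fun oa => if oa is Some x then x \in srcs i f else true)
  (fun ob => if ob is Some x then x \in tgts i f else true)
  (fun oa ob =>
   step_wt f i (Some (oa, ob)) * G match oa, ob with
    | None, None => #|srcs i f|.+1
    | Some _, Some _ => #|srcs i f|.-1
    | _, _ => #|srcs i f|
    end)) /=.
rewrite big_optionE /= big_optionE /=.
rewrite (eq_bigr _ (fun a _ => big_optionE _ _)) /= big_split /=.
(* For peaks the target is fixed first, because the rank depends on it alone; the source only
   decides whether a cycle is completed. *)
rewrite -!big_distrl /= !sum_rank card_tgts // exchange_big /=.
have closing b : b \in tgts i f ->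
    \sum_(a in srcs i f) pw i #|srcs i f| #|[set x in tgts i f | (x < b)%N]| *
      (if a == path_end f b then lam else 1) * G #|srcs i f|.-1
    = pw i #|srcs i f| #|[set x in tgts i f | (x < b)%N]|
      * ((lam + #|srcs i f|.-1%:R) * G #|srcs i f|.-1).
  move=> tb; rewrite -big_distrl -big_distrr /= -mulrA; congr (_ * (_ * _)).
  have se := path_end_srcs pf tb.
  rewrite (bigD1 _ se) /= eqxx; congr (_ + _).
  rewrite (eq_bigr (fun=> 1)); last by move=> a /andP[_ /negPf->].
  rewrite sumr_const (cardsD1 (path_end f b)) se /=.
  by congr (1 *+ _); apply: eq_card => a; rewrite in_setD1 andbC.
rewrite (eq_bigr _ closing) -big_distrl /= sum_rank card_tgts //.
ring.
Qed.

(** Induction on the number of unread points, splitting the permutations by the code of the next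
    one; [restr_full] is the base case. *)
Lemma sum_local_wt_restr f (n : nat) : (n <= N)%N -> pinj n f ->
  \sum_(s | restr n s == f) \prod_(i : 'I_N | (n <= i)%N) local_wt s i
  = walk (N - n) n #|srcs n f|.
Proof.
move=> leN; move eN: (N - n)%N => len.
elim: len n f leN eN => [|len IHlen] n f leN eN pf.
  have {leN eN} ? : n = N by lia.
  subst n; rewrite (eq_bigr (fun=> 1)) => [|s _]; last first.
    by rewrite big_pred0 // => i; rewrite leqNgt ltn_ord.
  rewrite sumr_const [RHS]/= -restr_full //; congr (1 *+ _).
  by apply: eq_card => s; rewrite [RHS]inE.
have ltn : (n < N)%N by lia.
pose i := Ordinal ltn.
rewrite -[n]/(i : nat) in pf *.
rewrite (partition_big (fun s => code s i) (admissible f i)); last first.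
  by move=> s /eqP <-; apply: admissible_code.
transitivity (\sum_(c | admissible f i c)
    step_wt f i c * walk len i.+1 #|srcs i.+1 (ext f i c)|); last exact: sum_step_wt.
apply: eq_bigr => c adm.
rewrite -IHlen //=; [|lia|exact: pinj_ext].
rewrite big_distrr /=; apply: eq_big => [s|s /andP[/eqP sf /eqP sc]].
  by rewrite -(restrS_eq s pf adm).
rewrite (bigD1 i) //= /local_wt sf sc; congr (_ * _).
apply: eq_bigl => j; rewrite ltn_neqAle andbC -(inj_eq val_inj) /= eq_sym.
by [].
Qed.

Lemma sum_local_wt :
  \sum_(s : 'S_N) \prod_(i < N) local_wt s i = walk N 0 0.
Proof.
have r0 s : restr 0 s = [ffun=> None] by apply/ffunP => a; rewrite !ffunE.
have p0 : pinj 0 ([ffun=> None] : {ffun 'I_N -> option 'I_N}).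
  by split => [a b|a a' b]; rewrite !ffunE.
have := sum_local_wt_restr (leq0n N) p0; rewrite subn0.
have -> : srcs 0 ([ffun=> None] : {ffun 'I_N -> option 'I_N}) = set0.
  by apply/setP => x; rewrite !inE.
rewrite cards0 => <-; apply: eq_bigl => s; by rewrite r0 eqxx.
Qed.

End Walks.

(** * Local form of the statistics *)

Section LocalStatistics.
Variable N : nat.
Implicit Types (s : 'S_N) (i j k a b l : 'I_N).

(** Serves to count the triples of crossings and nestings by a single index, which determines the
    other two entries. *)
Lemma card_image_set (T T' : finType) (A : {set T}) (B : {set T'}) (F : T -> T') :
  injective F -> (forall t, reflect (exists2 a, a \in A & t = F a) (t \in B)) ->
  #|B| = #|A|.
Proof.
move=> injF memB; rewrite -(card_imset (mem A) injF); apply: eq_card => t.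
by apply/memB/imsetP => -[a Aa ->]; exists a.
Qed.

Lemma ucrossE s j : ucross s j = #|[set a : 'I_N | [&& (a < j)%N, (j < s a)%N & (s a < s j)%N]]|.
Proof.
apply: (@card_image_set _ _ _ _ (fun a => (a, s a, s j))) => [a b [] //|[[i k] l]].
rewrite inE; apply: (iffP idP) => [/and5P[ij jk kl /eqP ek /eqP el]|[a] /[!inE] /and3P[? ? ?] [-> -> ->]].
  by exists i; rewrite ?inE -?ek -?el ?ij ?jk.
by rewrite !eqxx; apply/and5P.
Qed.

Lemma unestE s j : unest s j = #|[set a : 'I_N | [&& (a < j)%N, (j < s j)%N & (s j < s a)%N]]|.
Proof.
apply: (@card_image_set _ _ _ _ (fun a => (a, s j, s a))) => [a b [] //|[[i k] l]].
rewrite inE; apply: (iffP idP) => [/and5P[ij jk kl /eqP ek /eqP el]|[a] /[!inE] /and3P[? ? ?] [-> -> ->]].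
  by exists i; rewrite ?inE -?ek -?el ?ij ?jk.
by rewrite !eqxx; apply/and5P.
Qed.

Lemma lcrossE s k : lcross s k = #|[set l : 'I_N | [&& (s k < s l)%N, (s l < k)%N & (k < l)%N]]|.
Proof.
apply: (@card_image_set _ _ _ _ (fun l => (s k, s l, l))) => [a b [] //|[[i j] l]].
rewrite inE; apply: (iffP idP) => [/and5P[ij jk kl /eqP ei /eqP ej]|[a] /[!inE] /and3P[? ? ?] [-> -> ->]].
  by exists l; rewrite ?inE -?ei -?ej ?ij ?jk.
by rewrite !eqxx; apply/and5P.
Qed.

Lemma lnestE s k : lnest s k = #|[set l : 'I_N | [&& (s l < s k)%N, (s k < k)%N & (k < l)%N]]|.
Proof.
apply: (@card_image_set _ _ _ _ (fun l => (s l, s k, l))) => [a b [] //|[[i j] l]].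
rewrite inE; apply: (iffP idP) => [/and5P[ij jk kl /eqP ei /eqP ej]|[a] /[!inE] /and3P[? ? ?] [-> -> ->]].
  by exists l; rewrite ?inE -?ei -?ej ?ij ?jk.
by rewrite !eqxx; apply/and5P.
Qed.

Lemma ucross'E s k : ucross' s k =
  #|[set j : 'I_N | [&& ((s^-1)%g k < j)%N, (j < k)%N & (k < s j)%N]]|.
Proof.
apply: (@card_image_set _ _ _ _ (fun j => ((s^-1)%g k, j, s j))) => [a b [] //|[[i j] l]].
rewrite inE; apply: (iffP idP) => [/and5P[ij jk kl /eqP ei /eqP ej]|[a] /[!inE] /and3P[? ? ?] [-> -> ->]].
  by exists j; rewrite ?inE ?ei ?permK -?ei -?ej ?ij ?jk.
by rewrite permKV !eqxx; apply/and5P.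
Qed.

Lemma unest'E s k : unest' s k =
  #|[set i : 'I_N | [&& (i < (s^-1)%g k)%N, ((s^-1)%g k < k)%N & (k < s i)%N]]|.
Proof.
apply: (@card_image_set _ _ _ _ (fun i => (i, (s^-1)%g k, s i))) => [a b [] //|[[i j] l]].
rewrite inE; apply: (iffP idP) => [/and5P[ij jk kl /eqP ei /eqP ej]|[a] /[!inE] /and3P[? ? ?] [-> -> ->]].
  by exists i; rewrite ?inE ?ei ?permK -?ei -?ej ?ij ?jk.
by rewrite permKV !eqxx; apply/and5P.
Qed.

(** * Heights, ranks and records *)

Definition height s i : nat := #|srcs i (restr i s)|.

Lemma pinj_restr n s : pinj n (restr n s).
Proof.
split=> [a b|a a' b]; rewrite !ffunE.
  by case: ifP => // /andP[la lb] [<-].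
by case: ifP => // _ [<-]; case: ifP => // _ [/perm_inj].
Qed.

(** Open sources and open targets are equally many, so one of either kind forces one of the
    other. *)
Lemma srcs_tgts n s b : b \in tgts n (restr n s) -> exists2 a : 'I_N, (a < n)%N & (n <= s a)%N.
Proof.
move=> tb; have : (0 < #|srcs n (restr n s)|)%N.
  by rewrite -card_tgts; [apply/card_gt0P; exists b | exact: pinj_restr].
by case/card_gt0P => a; rewrite srcs_restr => /andP[]; exists a.
Qed.

Lemma tgts_srcs n s a : a \in srcs n (restr n s) -> exists2 b : 'I_N, (n <= b)%N & (s b < n)%N.
Proof.
move=> ta; have : (0 < #|tgts n (restr n s)|)%N.
  by rewrite card_tgts; [apply/card_gt0P; exists a | exact: pinj_restr].
by case/card_gt0P => b; rewrite tgts_restr => /andP[]; exists ((s^-1)%g b); rewrite ?permKV.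
Qed.

(** Before [i] is read, [s i] is an open target, so there is an open source, sent to [i] or
    beyond. *)
Lemma drop_nrecord s i : (s i < i)%N -> record s i = false.
Proof.
move=> lt; have /srcs_tgts[a la lsa] : s i \in tgts i (restr i s).
  by rewrite tgts_restr permK lt leqnn.
apply/negbTE/forallPn; exists a; rewrite la /= -leqNgt; lia.
Qed.

Lemma rise_nantirecord s i : (i < s i)%N -> antirecord s i = false.
Proof.
move=> lt; have /tgts_srcs[b lb lsb] : i \in srcs i.+1 (restr i.+1 s).
  by rewrite srcs_restr lt leqnn.
apply/negbTE/forallPn; exists b; rewrite lb /= -leqNgt; lia.
Qed.

Lemma rar_fixpt s i : rar s i -> s i = i.
Proof.
rewrite /rar => /andP[r ar]; apply: val_inj => /=.
case: (ltngtP (s i) i) => // [/drop_nrecord|/rise_nantirecord].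
  by rewrite r.
by rewrite ar.
Qed.

(** A violation is an arc passing over [i] from the left, that is an open source; for antirecords it
    is an open target. So a fixed point is a record-antirecord at height 0 and neither at positive
    height. *)
Lemma fixpt_record s i : s i = i -> record s i = (height s i == 0%N).
Proof.
move=> si; rewrite /height cards_eq0; apply/forallP/eqP => [H|H a].
  apply/setP => a; rewrite srcs_restr inE; apply/negbTE/negP => /andP[la].
  by have := H a; rewrite la si /= ltnNge => /negPf->.
apply/implyP => la; rewrite si ltnNge; apply/negP => le.
by have := in_set0 a; rewrite -H srcs_restr la le.
Qed.

Lemma fixpt_antirecord s i : s i = i -> antirecord s i = (height s i == 0%N).
Proof.
move=> si; rewrite /height -card_tgts; last exact: pinj_restr.
rewrite cards_eq0; apply/forallP/eqP => [H|H a].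
  apply/setP => b; rewrite tgts_restr inE; apply/negbTE/negP => /andP[lb lsb].
  have := H ((s^-1)%g b); rewrite permKV si; move: lsb; rewrite leq_eqVlt.
  case/predU1P => [/ord_inj e _|-> /=]; last by rewrite ltnNge ltnW.
  by move: lb; rewrite -[b](permKV s) -e si ltnn.
apply/implyP => la; rewrite si ltnNge leq_eqVlt negb_or; apply/andP; split.
  apply: contraTneq la => /ord_inj e; rewrite -leqNgt.
  by have /perm_inj-> : s a = s i by rewrite e.
apply/negP => lt; have := in_set0 (s a).
by rewrite -H tgts_restr permK lt ltnW.
Qed.

(** Injectivity of [s] in a form that [lia] can use. *)
Lemma perm_eq_nat s a b : s a = b :> nat -> a = (s^-1)%g b :> nat.
Proof. by move/ord_inj <-; rewrite permK. Qed.

Lemma fixpt_psnest s i : s i = i -> psnest s i = height s i.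
Proof.
move=> si; apply: eq_card => a; rewrite inE srcs_restr.
have := @perm_eq_nat s a i; rewrite -{2}si permK; lia.
Qed.

(** Every open source has its arc over the valley, ending either before [s i] (crossing) or after it
    (nesting). *)
Lemma cval_height s i : cval s i -> (ucross s i + unest s i)%N = height s i.
Proof.
rewrite /cval => /andP[li lsi]; rewrite ucrossE unestE /height.
rewrite -(cardsID [set a | (s a < s i)%N] (srcs _ _)).
by congr addn; apply: eq_card => a; rewrite in_set ?in_setD ?in_setI srcs_restr !in_set;
  have := @perm_eq_nat s a i; have := @perm_eq_nat s a (s i); rewrite permK; lia.
Qed.

Lemma cdrise_rank s i : cdrise s i ->
  #|[set x in srcs i (restr i s) | (x < (s^-1)%g i)%N]| = unest' s i.
Proof.
rewrite /cdrise => /andP[li lsi]; rewrite unest'E; apply: eq_card => a.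
rewrite inE srcs_restr inE; have := @perm_eq_nat s a i; lia.
Qed.

(** The successor accounts for the source closed at [i]; open sources after it give crossings, those
    before it nestings. *)
Lemma cdrise_height s i : cdrise s i ->
  (ucross' s i + unest' s i).+1 = height s i.
Proof.
rewrite /cdrise => /andP[li lsi]; rewrite unest'E ucross'E /height.
rewrite (cardsD1 ((s^-1)%g i)) srcs_restr permKV li leqnn add1n; congr _.+1.
rewrite -(cardsID [set a : 'I_N | ((s^-1)%g i < a)%N] (_ :\ _)).
by congr addn; apply: eq_card => a; rewrite [LHS]in_set ?in_setI !in_setD srcs_restr !inE -(inj_eq val_inj) /=;
  have := @perm_eq_nat s a i; lia.
Qed.

Lemma cdrise_record s i : cdrise s i -> record s ((s^-1)%g i) = (unest' s i == 0%N).
Proof.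
rewrite /cdrise => /andP[li lsi]; rewrite unest'E cards_eq0.
apply/forallP/eqP => [H|/setP H a].
  apply/setP => a; rewrite !inE; have := H a; rewrite permKV; lia.
have := H a; rewrite !inE permKV; have := @perm_eq_nat s a i; lia.
Qed.

(** Open targets are renamed by their preimages, the indices counted by [lcrossE] and [lnestE]. *)
Lemma card_tgts_restr s (n : nat) (P : pred 'I_N) :
  #|[set x in tgts n (restr n s) | P x]| = #|[set l : 'I_N | [&& (n <= l)%N, (s l < n)%N & P (s l)]]|.
Proof.
apply: (@card_image_set _ _ _ _ s) => [|b]; first exact: perm_inj.
rewrite inE tgts_restr; apply: (iffP idP) => [/andP[/andP[lb lsb] Pb]|[a]].
  by exists ((s^-1)%g b); rewrite ?inE ?permKV ?lb ?lsb.
by rewrite inE => /and3P[la lsa Pa] ->; rewrite permK la lsa.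
Qed.

Lemma drop_rank s i : (s i < i)%N ->
  #|[set x in tgts i (restr i s) | (x < s i)%N]| = lnest s i.
Proof.
move=> lsi; rewrite card_tgts_restr lnestE; apply: eq_card => l; rewrite !inE.
by case: (i =P l) => [<-|/eqP]; rewrite -?(inj_eq val_inj) /=; lia.
Qed.

Lemma drop_height s i : (s i < i)%N -> (lcross s i + lnest s i).+1 = height s i.
Proof.
move=> lsi; rewrite /height -card_tgts; last exact: pinj_restr.
rewrite -[tgts _ _](setIidPl (subsetT _)).
have -> : tgts i (restr i s) :&: setT = [set x in tgts i (restr i s) | predT x].
  by apply/setP => x; rewrite !inE !andbT.
rewrite card_tgts_restr lcrossE lnestE [RHS](cardsD1 i) inE leqnn lsi add1n; congr _.+1.
rewrite -(cardsID [set l : 'I_N | (s i < s l)%N] (_ :\ _)).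
by congr addn; apply: eq_card => l; rewrite [LHS]in_set ?in_setI !in_setD !inE -(inj_eq val_inj) /=;
  have := @perm_eq_nat s l (s i); rewrite permK; lia.
Qed.

Lemma drop_antirecord s i : (s i < i)%N -> antirecord s i = (lnest s i == 0%N).
Proof.
move=> lsi; rewrite lnestE cards_eq0.
apply/forallP/eqP => [H|/setP H l].
  apply/setP => l; rewrite !inE; have := H l; lia.
have := H l; rewrite !inE; have := @perm_eq_nat s l (s i); rewrite permK; lia.
Qed.

(** * Cycles and their largest elements *)

Definition cycle_max s i : bool := [forall j in porbit s i, (j <= i)%N].

(** Each cycle is counted at its largest element, the point whose reading completes it; this makes
    the number of cycles a local statistic. *)
Lemma ncyc_cycle_max s : ncyc s = #|[set i | cycle_max s i]|.
Proof.
rewrite /ncyc -(@card_in_imset _ _ (porbit s) (mem [set i | cycle_max s i])).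
  apply: eq_card => C; apply/imsetP/imsetP => [[x _ ->]|[x _ ->]]; last by exists x.
  have xx : x \in porbit s x := porbit_id s x.
  case: (arg_maxnP (fun y : 'I_N => y : nat) xx) => y xy ymax.
  have e : porbit s x = porbit s y by apply/eqP; rewrite eq_porbit_mem porbit_sym.
  exists y => //; rewrite inE; apply/forall_inP => z; rewrite -e; exact: ymax.
move=> i j; rewrite !inE => /forall_inP mi /forall_inP mj e; apply: ord_inj.
by apply/eqP; rewrite eqn_leq mj ?mi // -?e ?porbit_id // e porbit_id.
Qed.

Lemma fixpt_cycle_max s i : s i = i -> cycle_max s i.
Proof.
move=> si; apply/forall_inP => j /porbitP[n ->].
suff -> : (s ^+ n)%g i = i by [].
by elim: n => [|n IH]; rewrite ?expg0 ?perm1 // expgSr permM IH.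
Qed.

Lemma porbit_step s i j : j \in porbit s i -> s j \in porbit s i.
Proof. by case/porbitP => n ->; rewrite -permM -expgSr mem_porbit. Qed.

Lemma rise_ncycle_max s i : (i < s i)%N -> cycle_max s i = false.
Proof.
move=> lt; apply/negbTE/forall_inPn; exists (s i); last by rewrite -ltnNge.
by rewrite porbit_step // porbit_id.
Qed.

Lemma inv_rise_ncycle_max s i : (i < (s^-1)%g i)%N -> cycle_max s i = false.
Proof.
move=> lt; apply/negbTE/forall_inPn; exists ((s^-1)%g i); last by rewrite -ltnNge.
by rewrite porbit_sym -{1}[i](permKV s) porbit_step // porbit_id.
Qed.

(* At a cycle peak [i], the cycle of [i] stays below [i] exactly when the path of
   arcs among the points [< i] which starts at [s i] leads back to [i]. *)
Lemma cpeak_cycle_max s i : cpeak s i ->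
  cycle_max s i = ((s^-1)%g i == path_end (restr i s) (s i)).
Proof.
rewrite /cpeak => /andP[_ lsi].
have tb : s i \in tgts i (restr i s) by rewrite tgts_restr permK lsi leqnn.
have := path_end_srcs (pinj_restr i s) tb.
set e := path_end _ _; rewrite srcs_restr => /andP[le lse].
pose g (y : 'I_N) := odflt y (restr i s y).
have gE (y : 'I_N) : g y = if ((y < i) && (s y < i))%N then s y else y.
  by rewrite /g ffunE; case: ifP.
have g_in m : iter m g (s i) \in porbit s i.
  elim: m => /= [|m IH]; first by rewrite porbit_step // porbit_id.
  by rewrite gE; case: ifP => // _; apply: porbit_step.
have g_lt m : (iter m g (s i) < i)%N.
  by elim: m => //= m IH; rewrite gE; case: ifP => // /andP[].
apply/forall_inP/eqP => [mx|ei].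
  (* The image of [e] is at most [i] by maximality, and at least [i] because [e] is an open
     source. *)
  have lei := mx _ (porbit_step (g_in N)).
  suff <- : s e = i by rewrite permK.
  by apply/ord_inj/eqP; rewrite eqn_leq lse andbT.
have se : s e = i by rewrite -ei permKV.
have fe : restr i s (iter N g (s i)) = None.
  by rewrite -/(path_end _ _) -/e ffunE se ltnn andbF.
suff H n : (s ^+ n)%g i = i \/ exists m, (s ^+ n)%g i = iter m g (s i).
  by move=> j /porbitP[n ->]; case: (H n) => [->|[m ->]] //; apply: ltnW.
elim: n => [|n IH]; first by left; rewrite expg0 perm1.
rewrite expgSr permM; case: IH => [->|[m ->]]; first by right; exists 0%N.
case: (ltnP (s (iter m g (s i))) i) => [lt|gt].
  by right; exists m.+1; rewrite /= gE g_lt lt.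
have fm : restr i s (iter m g (s i)) = None by rewrite ffunE g_lt ltnNge gt.
(* The path stops at this iterate, which is therefore its end [e], and [s] sends [e] to [i]. *)
left; suff -> : iter m g (s i) = e by [].
case: (leqP m N) => [lemN|/ltnW leNm]; first by rewrite /e /path_end (path_end_stop fm).
by rewrite (path_end_stop fe).
Qed.

End LocalStatistics.

(** * T-fractions and alternating walks *)

Section Fractions.
Variable R : comNzRingType.
Implicit Types (f g : nat -> R) (n k : nat).

(** * Cauchy products of coefficient sequences *)

Lemma eq_fps_mul f f' g g' n :
  (forall k, (k <= n)%N -> f k = f' k) -> (forall k, (k <= n)%N -> g k = g' k) ->
  fps_mul f g n = fps_mul f' g' n.
Proof.
move=> ef eg; apply: eq_bigr => k _; rewrite ef ?eg ?leq_subr //.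
by rewrite -ltnS.
Qed.

(** Coefficient [n] involves no higher coefficients of the factors, so the ring laws of polynomials
    transfer by truncation. *)
Lemma fps_mul_poly f g n :
  fps_mul f g n = ((\poly_(k < n.+1) f k) * (\poly_(k < n.+1) g k))`_n.
Proof.
rewrite coefM; apply: eq_bigr => k _; rewrite !coef_poly ltn_ord ltnS leq_subr //.
Qed.

Lemma fps_mulC f g n : fps_mul f g n = fps_mul g f n.
Proof. by rewrite !fps_mul_poly mulrC. Qed.

Lemma fps_mulA f g (h : nat -> R) n : fps_mul f (fps_mul g h) n = fps_mul (fps_mul f g) h n.
Proof.
pose P u : {poly R} := \poly_(k < n.+1) u k.
have PM u v k : (k <= n)%N -> fps_mul u v k = (P u * P v)`_k.
  move=> lekn; rewrite coefM; apply: eq_bigr => j _; rewrite !coef_poly !ltnS.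
  by rewrite (leq_trans (leq_subr _ _) lekn) (leq_trans _ lekn) // -ltnS.
have PC u k : (k <= n)%N -> (P u)`_k = u k by move=> lekn; rewrite coef_poly ltnS lekn.
transitivity ((P f * (P g * P h))`_n).
  rewrite coefM; apply: eq_bigr => k _; rewrite PC ?PM ?leq_subr //.
  by rewrite -ltnS.
rewrite mulrA coefM; apply: eq_bigr => k _; rewrite PC ?PM ?leq_subr //.
by rewrite -ltnS.
Qed.

Lemma fps_mulZr f g c n : fps_mul f (fun k => c * g k) n = c * fps_mul f g n.
Proof. by rewrite /fps_mul big_distrr; apply: eq_bigr => k _; rewrite /= mulrCA. Qed.

Lemma fps_mul_shift f g g' c n :
  g 0%N = 0 -> (forall k, (k <= n)%N -> g k.+1 = c * g' k) ->
  fps_mul f g n.+1 = c * fps_mul f g' n.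
Proof.
move=> g0 gS; rewrite /fps_mul big_ord_recr /= subnn g0 mulr0 addr0 big_distrr.
apply: eq_bigr => k _ /=.
have lek : (k <= n)%N by rewrite -ltnS.
by rewrite subSn // gS ?leq_subr // mulrCA.
Qed.

(* [F = 1 / (1 - d t - a t G)] in terms of coefficients. *)
Definition J_step (d a : R) (G F : nat -> R) : Prop :=
  F 0%N = 1 /\ forall n, F n.+1 = d * F n + a * fps_mul G F n.

Lemma fps_inv_J_step d a G : J_step d a G (fps_inv (T_denominator d a G)).
Proof.
set g := T_denominator d a G; have Vg := @fps_mul_inv R g (erefl _).
split=> [|n].
  by have := Vg 0%N; rewrite /fps_mul big_ord_recl big_ord0 /= mulr1 addr0.
have := Vg n.+1; rewrite {1}/fps_mul big_ord_recr /= subnn mulr1 /fps_one /=.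
move/eqP; rewrite addrC addr_eq0 => /eqP ->.
(* Only the term [k = n] is nonzero; written as a convolution, it merges with the other sums. *)
have -> : d * fps_inv g n = \sum_(k < n.+1) fps_inv g k * (d *+ (n - k == 0)%N).
  rewrite big_ord_recr /= subnn mulrC big1 ?add0r // => k _.
  by rewrite subn_eq0 leqNgt ltn_ord mulr0.
rewrite fps_mulC /fps_mul big_distrr -big_split -sumrN /=; apply: eq_bigr => k _.
have lek : (k <= n)%N by rewrite -ltnS.
by rewrite subSn //= mulrBr mulrN opprB opprK addrC mulrCA.
Qed.

(** This is [F = 1 + d t F + a t G F] multiplied by [X]. *)
Lemma J_step_mul d a G F X n : J_step d a G F ->
  fps_mul F X n.+1 = X n.+1 + d * fps_mul F X n + a * fps_mul G (fps_mul F X) n.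
Proof.
move=> [F0 FS]; rewrite fps_mulA {1}/fps_mul big_ord_recl F0 mul1r subn0 -addrA.
congr (_ + _); rewrite /fps_mul !big_distrr -big_split /=.
by apply: eq_bigr => k _; rewrite FS subSS mulrDl -!mulrA.
Qed.

Variables delta alpha : nat -> R.

Lemma T_convergent_step m i :
  J_step (delta i) (alpha i) (T_convergent delta alpha m i.+1)
    (T_convergent delta alpha m.+1 i).
Proof. exact: fps_inv_J_step. Qed.

(** Each level brings a factor [t], so what lies deeper than [n] levels cannot reach coefficient
    [n]. *)
Lemma T_convergent_stable n m m' i : (n <= m)%N -> (n <= m')%N ->
  T_convergent delta alpha m i n = T_convergent delta alpha m' i n.
Proof.
have T0 k j : T_convergent delta alpha k j 0%N = 1.
  by case: k => // k; case: (T_convergent_step k j).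
elim/ltn_ind: n m m' i => -[|n] IHn [|m] [|m'] i // lem lem'; rewrite ?T0 //.
case: (T_convergent_step m i) (T_convergent_step m' i) => [_ ->] [_ ->].
congr (_ * _ + _ * _); first by apply: IHn => //; apply: leqW.
by apply: eq_fps_mul => k lek; apply: IHn => //; apply: leq_trans lek _; rewrite // ltnW.
Qed.

Definition T_limit i n : R := T_convergent delta alpha n i n.

Lemma T_limit_step i : J_step (delta i) (alpha i) (T_limit i.+1) (T_limit i).
Proof.
split=> // n; rewrite /T_limit; case: (T_convergent_step n i) => _ ->.
congr (_ * _ + _ * _); first exact: T_convergent_stable.
by apply: eq_fps_mul => k lek; apply: T_convergent_stable; rewrite // leqW.
Qed.

(* [E n h] and [O n h] are the total weights of the walks with [2n] and [2n+1]
   remaining steps from height [h].  Height [h] is level [2h] of the Dyck path at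
   even times and level [2h-1] at odd times, so that the first step back below a
   level factors the generating functions: [O_h = D_h T_(2h) E_(h-1)] and
   [E_h = t A_h T_(2h+1) O_h]. *)
Lemma T_limit_walk (U A B D : nat -> R) (E O : nat -> nat -> R) :
  D 0%N = 0 -> (forall h, E 0%N h = (h == 0%N)%:R) ->
  (forall n h, E n.+1 h = U h * O n h.+1 + A h * O n h) ->
  (forall n h, O n h = B h * E n h + D h * E n h.-1) ->
  (forall h, alpha h.*2.+1 = U h * D h.+1) ->
  (forall h, alpha h.+1.*2 = A h.+1 * B h.+1) ->
  delta 1%N = A 0%N * B 0%N -> (forall i, (2 <= i)%N -> delta i = 0) ->
  forall n, E n 0%N = T_limit 1 n.
Proof.
move=> D0 E0 ES OE aodd aeven d1 d2.
(* With these products the factorizations read [E_(h+1) = t A_(h+1) GE_h] and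
   [O_(h+1) = D_(h+1) GO_h]. *)
pose GE h := fps_mul (T_limit h.+1.*2.+1) (O^~ h.+1).
pose GO h := fps_mul (T_limit h.+1.*2) (E^~ h).
have dz i : (1 < i)%N -> forall x : R, delta i * x = 0 by move=> /d2->; exact: mul0r.
have GES h n : GE h n.+1 =
    O n.+1 h.+1 + U h.+1 * D h.+2 * fps_mul (T_limit h.+2.*2) (GE h) n.
  by rewrite /GE (J_step_mul _ _ (T_limit_step _)) dz ?addr0 // aodd.
have GOS h n : GO h n.+1 =
    E n.+1 h + A h.+1 * B h.+1 * fps_mul (T_limit h.+1.*2.+1) (GO h) n.
  by rewrite /GO (J_step_mul _ _ (T_limit_step _)) dz ?addr0 // aeven.
have G0 i X : fps_mul (T_limit i) X 0 = X 0%N.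
  by rewrite /fps_mul big_ord1; case: (T_limit_step i) => ->; rewrite mul1r.
(* The three identities need one another in the induction. The factor [t] shifts the second one,
   which asserts nothing at [n = 0]. *)
suff H n : [/\ E n 0%N = T_limit 1 n,
    (forall h, (if n is k.+1 then E n h.+1 = A h.+1 * GE h k else True)) &
    forall h, O n h.+1 = D h.+1 * GO h n].
  by move=> n; case: (H n).
elim/ltn_ind: n => -[_|n IHn].
  split=> // h.
  by rewrite OE !E0 /GO G0 E0 mulr0 add0r.
have HO k h : (k <= n)%N -> O k h.+1 = D h.+1 * GO h k by move=> /IHn[].
have HE h k : (k < n)%N -> E k.+1 h.+1 = A h.+1 * GE h k by move=> ltk; have [_ ->] := IHn k.+1 ltk.
have HE' h : E n.+1 h.+1 = A h.+1 * GE h n.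
  rewrite ES HO // /GO; case: n {IHn HO} HE => [|n] HE.
    by rewrite /GE !G0 E0 mulr0 mulr0 add0r.
  rewrite (@fps_mul_shift _ _ (GE h) (A h.+1)) ?E0 //; last by move=> k lek; rewrite HE.
  rewrite GES; ring.
split=> // [|h].
  rewrite ES HO // OE D0 mul0r addr0.
  have [_ ->] := T_limit_step 1; rewrite d1 (aodd 0%N) /GO.
  have [-> _ _] := IHn n (leqnn _).
  rewrite (@eq_fps_mul _ (T_limit 2) _ (T_limit 1)) //; last by move=> k /IHn[].
  ring.
rewrite OE HE' /= GOS /GE.
rewrite (@eq_fps_mul _ (T_limit h.+1.*2.+1) _ (fun k => D h.+1 * GO h k)) //;
  last by move=> k lek; rewrite HO.
by rewrite fps_mulZr; ring.
Qed.

End Fractions.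

(** * D-permutations *)

Section DPermutationWeights.
Variables (R : comNzRingType) (W : weights R).

(** An arc closed with rank [m] among [h] has [m] nestings and [h.-1 - m] crossings; rank 0 is the
    record or antirecord case. *)
Definition rank_wt (x u p q : R) (h m : nat) : R :=
  (if m == 0%N then x else u) * p ^+ (h.-1 - m) * q ^+ m.

Lemma sum_rank_wt (x u p q : R) (h : nat) :
  \sum_(m < h.+1) rank_wt x u p q h.+1 m = p ^+ h * x + q * pq_int h p q * u.
Proof.
rewrite big_ord_recl /rank_wt /= subn0 expr0 mulr1 [x * _]mulrC; congr (_ + _).
(* [pq_int] is indexed by the exponent of [p], the number of crossings, which decreases as the rank
   grows. *)
rewrite /pq_int (reindex_inj rev_ord_inj) /= big_distrr big_distrl /=.
apply: eq_bigr => m _; rewrite /bump /= add1n exprS.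
have -> : (h - (h - m.+1).+1 = m)%N by have := ltn_ord m; lia.
have -> : (h - m.+1 = h.-1 - m)%N by lia.
ring.
Qed.

(* The ordinal [i] carries the paper's label [i + 1]: [odd i] means an even
   label. *)
Definition fix_wt (n h : nat) : R :=
  lam W * (if odd n then (if h == 0%N then ze W else se W ^+ h * we W)
           else (if h == 0%N then zo W else so W ^+ h * wo W)).
Definition val_wt (n h : nat) : R := if odd n then 0 else y1 W * pp1 W ^+ h.
Definition rise_wt (n h m : nat) : R :=
  if odd n then 0 else rank_wt (hy2 W) (hv2 W) (hpp2 W) (hqp2 W) h m.
Definition fall_wt (n h m : nat) : R :=
  if odd n then rank_wt (x2 W) (u2 W) (pm2 W) (qm2 W) h m else 0.
Definition peak_wt (n h m : nat) : R :=
  if odd n then rank_wt (x1 W) (u1 W) (pm1 W) (qm1 W) h m else 0.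

Let loc (N : nat) (s : 'S_N) (i : 'I_N) : R :=
  local_wt (lam W) fix_wt val_wt rise_wt fall_wt peak_wt s i.

(** The share of [i] in the summand of [Phh], with the factors in the same order. *)
Definition stat_wt (N : nat) (s : 'S_N) (i : 'I_N) : R :=
  x1 W ^+ (earec s i && cpeak s i) * x2 W ^+ (earec s i && cdfall s i)
   * y1 W ^+ (erec s i && cval s i)
   * hy2 W ^+ (cdrise s i && record s ((s^-1)%g i))
   * u1 W ^+ (nrar s i && cpeak s i) * u2 W ^+ (nrar s i && cdfall s i)
   * v1 W ^+ (nrar s i && cval s i)
   * hv2 W ^+ (cdrise s i && ~~ record s ((s^-1)%g i))
   * we W ^+ [&& ~~ odd (label i), fixpt s i & nrar s i]
   * wo W ^+ [&& odd (label i), fixpt s i & nrar s i]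
   * ze W ^+ (~~ odd (label i) && rar s i) * zo W ^+ (odd (label i) && rar s i)
   * pm1 W ^+ (if cpeak s i then lcross s i else 0)
   * pm2 W ^+ (if cdfall s i then lcross s i else 0)
   * pp1 W ^+ (if cval s i then ucross s i else 0)
   * hpp2 W ^+ (if cdrise s i then ucross' s i else 0)
   * qm1 W ^+ (if cpeak s i then lnest s i else 0)
   * qm2 W ^+ (if cdfall s i then lnest s i else 0)
   * qp1 W ^+ (if cval s i then unest s i else 0)
   * hqp2 W ^+ (if cdrise s i then unest' s i else 0)
   * se W ^+ (if fixpt s i && ~~ odd (label i) then psnest s i else 0)
   * so W ^+ (if fixpt s i && odd (label i) then psnest s i else 0)
   * lam W ^+ cycle_max s i.

Lemma expr_sum (N : nat) (P : pred 'I_N) (F : 'I_N -> nat) (x : R) :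
  x ^+ (\sum_(i | P i) F i) = \prod_i x ^+ (if P i then F i else 0%N).
Proof. by rewrite big_mkcond /= (big_morph _ (exprD x) (expr0 x)). Qed.

Lemma expr_card (N : nat) (P : pred 'I_N) (x : R) :
  x ^+ #|[set i | P i]| = \prod_i x ^+ (P i : nat).
Proof.
rewrite -sum1dep_card expr_sum; apply: eq_bigr => i _.
by case: (P i).
Qed.

Lemma local_wt_stat (hv1 : v1 W = y1 W) (hqp1 : qp1 W = pp1 W) (N : nat) (s : 'S_N) (i : 'I_N) :
  (if odd (label i) then (i <= s i)%N else (s i <= i)%N) -> loc s i = stat_wt s i.
Proof.
rewrite /loc /local_wt /step_wt /code /stat_wt /fixpt /label /=.
rewrite /cpeak /cval /cdrise /cdfall /erec /earec /rar /nrar.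
have si_inv : (s^-1)%g i = i -> s i = i by move=> e; rewrite -{1}e permKV.
case: (s i =P i) => [si _|ne].
  have -> : (s^-1)%g i = i by rewrite -{1}si permK.
  rewrite si ltnn (fixpt_record si) (fixpt_antirecord si) (fixpt_psnest si).
  rewrite (fixpt_cycle_max si) -/(height s i) /fix_wt.
  case: (odd i); case: (height s i =P 0%N) => [->|_] /=;
  rewrite ?expr0 ?expr1; ring.
case: (ltngtP (s i) i) => [lt|lt|/ord_inj//]; last first.
  rewrite if_neg; case: (boolP (odd i)) => [//|oi _].
  rewrite (rise_nantirecord lt) (rise_ncycle_max lt).
  case: (ltngtP ((s^-1)%g i) i) => [lt'|lt'|/ord_inj/si_inv//] /=.
    have cr : cdrise s i by rewrite /cdrise lt lt'.
    rewrite (cdrise_rank cr) (cdrise_record cr) -/(height s i) -(cdrise_height cr).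
    rewrite /rise_wt (negPf oi) /rank_wt /= addnK !andbF.
    by case: eqP => [->|_] /=; rewrite !(expr0, expr1, mul1r, mulr1) ?mulrA.
  have cv : cval s i by rewrite /cval lt lt'.
  (* The specialization makes the valley weight depend on the height alone, whether or not [i] is a
     record. *)
  rewrite -/(height s i) -(cval_height cv) /val_wt (negPf oi) hv1 hqp1 !andbF exprD.
  by case: (record s i) => /=; rewrite !(expr0, expr1, mul1r, mulr1) ?mulrA.
rewrite if_neg; case: (boolP (odd i)) => [oi _|//].
rewrite (drop_nrecord lt) (drop_antirecord lt).
case: (ltngtP ((s^-1)%g i) i) => [lt'|lt'|/ord_inj/si_inv//] /=.
  have cp : cpeak s i by rewrite /cpeak lt lt'.
  rewrite (drop_rank lt) -/(height s i) -(drop_height lt) (cpeak_cycle_max cp).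
  rewrite /peak_wt oi /rank_wt /= addnK !andbF.
  by case: (_ == path_end _ _); case: (lnest s i =P 0%N) => [->|_] /=; rewrite !(expr0, expr1, mul1r, mulr1) ?mulrA.
rewrite (drop_rank lt) -/(height s i) -(drop_height lt) (inv_rise_ncycle_max lt').
rewrite /fall_wt oi /rank_wt /= addnK !andbF.
by case: (lnest s i =P 0%N) => [->|_] /=; rewrite !(expr0, expr1, mul1r, mulr1) ?mulrA.
Qed.

(** The parity tests in the step weights kill every permutation outside [in_D], so the walk may sum
    over all permutations. *)
Lemma local_wt_eq0 (N : nat) (s : 'S_N) (i : 'I_N) :
  ~~ (if odd (label i) then (i <= s i)%N else (s i <= i)%N) -> loc s i = 0.
Proof.
rewrite /loc /local_wt /step_wt /code /label /= if_neg -(inj_eq val_inj) /=.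
rewrite /val_wt /rise_wt /fall_wt /peak_wt.
case: (odd i); rewrite -ltnNge => lt.
  rewrite gtn_eqF // (ltnNge (s i)) (ltnW lt) /=.
  by case: ifP.
rewrite ltn_eqF // lt.
by case: ifP; rewrite ?mul0r.
Qed.

Lemma Phh_walk (hv1 : v1 W = y1 W) (hqp1 : qp1 W = pp1 W) (n : nat) :
  Phh W n = walk (lam W) fix_wt val_wt rise_wt fall_wt peak_wt n.*2 0 0.
Proof.
rewrite -sum_local_wt (bigID (@in_D n)) /= [X in _ = _ + X]big1 ?addr0.
  apply: eq_bigr => s /forallP sD.
  rewrite (eq_bigr (stat_wt s)) => [|i _]; last exact: local_wt_stat.
  rewrite /stat_wt !big_split /= -!expr_card -!expr_sum -ncyc_cycle_max.
  by [].
move=> s /forallPn[i nD]; rewrite (bigD1 i) //=.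
by have := local_wt_eq0 nD; rewrite /loc => ->; rewrite mul0r.
Qed.

Lemma walkS (lam' : R) fw vw rw lw pw len n h :
  walk lam' fw vw rw lw pw len.+1 n h =
    vw n h * walk lam' fw vw rw lw pw len n.+1 h.+1
    + (fw n h + \sum_(m < h) rw n h m + \sum_(m < h) lw n h m)
      * walk lam' fw vw rw lw pw len n.+1 h
    + (lam' + h.-1%:R) * (\sum_(m < h) pw n h m) * walk lam' fw vw rw lw pw len n.+1 h.-1.
Proof. by []. Qed.

(** The weights see the position only through its parity. *)
Lemma walk_parity len n h :
  walk (lam W) fix_wt val_wt rise_wt fall_wt peak_wt len n.+2 h =
  walk (lam W) fix_wt val_wt rise_wt fall_wt peak_wt len n h.
Proof.
elim: len n h => //= len IHlen n h; rewrite !IHlen.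
by rewrite /fix_wt /val_wt /rise_wt /fall_wt /peak_wt /= negbK.
Qed.

End DPermutationWeights.

(* The source prints pp1 ^+ k in alpha_(2k-1).  That is false already at the
   coefficient of t: for k = 1 it gives alpha_1 = lam * pp1 * y1 * x1, whereas
   the permutation (1 2) has weight lam * y1 * x1.  The exponent is k - 1. *)
Theorem theorem4p7 (R : comNzRingType) (W : weights R)
    (hv1 : v1 W = y1 W) (hqp1 : qp1 W = pp1 W)
    (alpha delta : nat -> R)
    (alpha_odd : forall k : nat, (1 <= k)%N ->
      alpha (k.*2.-1) =
        (lam W + (k.-1)%:R) * pp1 W ^+ k.-1 * y1 W
        * (pm1 W ^+ k.-1 * x1 W
           + qm1 W * pq_int k.-1 (pm1 W) (qm1 W) * u1 W))
    (alpha_even : forall k : nat, (1 <= k)%N ->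
      alpha (k.*2) =
        (pm2 W ^+ k.-1 * x2 W
           + qm2 W * pq_int k.-1 (pm2 W) (qm2 W) * u2 W
           + lam W * se W ^+ k * we W)
        * (hpp2 W ^+ k.-1 * hy2 W
           + hqp2 W * pq_int k.-1 (hpp2 W) (hqp2 W) * hv2 W
           + lam W * so W ^+ k * wo W))
    (delta_1 : delta 1%N = lam W ^+ 2 * ze W * zo W)
    (delta_ge2 : forall n : nat, (2 <= n)%N -> delta n = 0) :
  is_T_fraction delta alpha (Phh W).
Proof.
move=> n; exists n => m lenm; rewrite Phh_walk // (T_convergent_stable _ _ _ lenm (leqnn n)).
pose w := walk (lam W) (fix_wt W) (val_wt W) (rise_wt W) (fall_wt W) (peak_wt W).
(* At odd labels the steps are valleys ([U]) and level steps ([A]); at even labels they are level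
   steps ([B]) and peaks ([D]). *)
symmetry; apply: (@T_limit_walk _ delta alpha
  (fun h => y1 W * pp1 W ^+ h)
  (fun h => fix_wt W 0 h + \sum_(m < h) rise_wt W 0 h m)
  (fun h => fix_wt W 1 h + \sum_(m < h) fall_wt W 1 h m)
  (fun h => (lam W + h.-1%:R) * \sum_(m < h) peak_wt W 1 h m)
  (fun k h => w k.*2 0%N h) (fun k h => w k.*2.+1 1%N h)) => //.
- by rewrite big_ord0 mulr0.
- move=> k h; rewrite /w doubleS walkS.
  have -> : \sum_(m < h) fall_wt W 0 h m = 0 by rewrite big1.
  by rewrite addr0 mulr0 mul0r addr0.
- move=> k h; rewrite /w walkS !walk_parity.
  have -> : \sum_(m < h) rise_wt W 1 h m = 0 by rewrite big1.
  by rewrite /val_wt /= mul0r add0r addr0.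
- move=> h; rewrite (alpha_odd h.+1) // /peak_wt /= sum_rank_wt; ring.
- move=> h; rewrite (alpha_even h.+1) // /rise_wt /fall_wt /fix_wt /= !sum_rank_wt; ring.
(* At height 0 the only level steps are fixed points, of weights [lam * zo] and [lam * ze]. *)
- by rewrite !big_ord0 /fix_wt /= delta_1; ring.
Qed.
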